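(* Let $\mathcal{H}$ be the family of all $3$-graphs with at most $3$ edges, except for the $3$-graphs $\mathrm{TP}_3$, $\mathrm{SP}_3$, $\mathrm{LC}_3$ and any $3$-graph obtained from one of these three by adding isolated vertices. Then for every $3$-graph $H$: $$C_3(n,H)\le 7 \ \text{ for all } n \quad\text{if } H\in\mathcal{H},\qquad C_3(n,H)=\Omega\!\left(\left(\frac{\log^{(3)}(n)}{\log^{(4)}(n)}\right)^{1/16}\right)\quad\text{if } H\notin\mathcal{H},$$ where $\log^{(s)}(n)=\log\log\cdots\log n$ ($s$ iterated logarithms) and the implicit constant may depend on $H$.
   Context: An $r$-graph is an $r$-uniform hypergraph; $K_n^{(r)}$ is the complete $r$-graph on $n$ vertices. A copy of an $r$-graph $H$ in $K_n^{(r)}$ is a subhypergraph $T$ of $K_n^{(r)}$ isomorphic to $H$ (its vertex set is the image of all of $V(H)$, including isolated vertices). An $(n,r,H)$-local coloring with $k$ colors is a family of edge-colorings $f_v:E(K_n^{(r)})\to[k]$, one for each vertex $v$ of $K_n^{(r)}$, such that for every copy $T$ of $H$ in $K_n^{(r)}$ there is a vertex $u\in V(T)$ for which $f_u$ is rainbow on $T$, i.e. no two edges of $T$ receive the same color under $f_u$. The local rainbow coloring number $C_r(n,H)$ is the minimum $k$ for which an $(n,r,H)$-local coloring with $k$ colors exists. $\mathrm{TP}_3$: vertex set $\{a,b,c,d,e\}$, edges $\{a,b,c\},\{b,c,d\},\{c,d,e\}$. $\mathrm{SP}_3$: vertex set $\{a,b,c,d,e,f\}$, edges $\{a,b,c\},\{b,c,d\},\{d,e,f\}$.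 $\mathrm{LC}_3$: vertex set $\{a,b,c,d,e,f\}$, edges $\{a,b,d\},\{b,c,e\},\{a,c,f\}$. *)

(* Defs.v *)
From Stdlib Require Import Reals ClassicalDescription.
From mathcomp Require Import all_boot.
Set Implicit Arguments. Unset Strict Implicit. Unset Printing Implicit Defensive.

(* A 3-graph on m vertices is represented by its vertex type 'I_m and its
   edge set E : {set {set 'I_m}} (3-uniformity is a hypothesis of the theorem). *)

Definition TP3 : {set {set 'I_5}} :=
  [set [set inord 0; inord 1; inord 2]; [set inord 1; inord 2; inord 3];
       [set inord 2; inord 3; inord 4]].
Definition SP3 : {set {set 'I_6}} :=
  [set [set inord 0; inord 1; inord 2]; [set inord 1; inord 2; inord 3];
       [set inord 3; inord 4; inord 5]].
Definition LC3 : {set {set 'I_6}} :=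
  [set [set inord 0; inord 1; inord 3]; [set inord 1; inord 2; inord 4];
       [set inord 0; inord 2; inord 5]].

Definition adds_isolated (p : nat) (X : {set {set 'I_p}}) (m : nat)
    (E : {set {set 'I_m}}) : Prop :=
  exists psi : 'I_p -> 'I_m, injective psi /\ E = [set psi @: e | e : {set 'I_p} in X].

Definition calH (m : nat) (E : {set {set 'I_m}}) : Prop :=
  (#|E| <= 3)%N /\ ~ adds_isolated TP3 E /\ ~ adds_isolated SP3 E
  /\ ~ adds_isolated LC3 E.

Definition rainbow_on (n m k : nat) (E : {set {set 'I_m}})
    (g : {set 'I_n} -> 'I_k) (phi : 'I_m -> 'I_n) : Prop :=
  forall e1 e2, e1 \in E -> e2 \in E ->
    g (phi @: e1) = g (phi @: e2) -> phi @: e1 = phi @: e2.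

(* An (n,3,H)-local colouring with k colours. Colourings are given on all
   subsets of [n]; only their values on 3-sets matter. Copies of H are the
   images of injections 'I_m -> 'I_n. *)
Definition local_coloring (n m k : nat) (E : {set {set 'I_m}})
    (f : 'I_n -> {set 'I_n} -> 'I_k) : Prop :=
  forall phi : 'I_m -> 'I_n, injective phi ->
    exists i : 'I_m, rainbow_on E (f (phi i)) phi.

Definition has_local_coloring (n m k : nat) (E : {set {set 'I_m}}) : Prop :=
  exists f : 'I_n -> {set 'I_n} -> 'I_k, local_coloring E f.

Definition has_lcb (n m : nat) (E : {set {set 'I_m}}) (k : nat) : bool :=
  if excluded_middle_informative (has_local_coloring n k E) then true else false.

(* C_3(n,H): least k admitting a local colouring (0 by convention if none
   exists, which only happens for the vertexless H). *)
Definition C3 (n m : nat) (E : {set {set 'I_m}}) : nat :=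
  match excluded_middle_informative (exists k, has_lcb n E k) with
  | left h => ex_minn h
  | right _ => 0
  end.

Definition iterlog (s : nat) (x : R) : R := Nat.iter s ln x.

(* Main.v *)
(* For a vertex v and a triple T of a linearly ordered set, the pair
   (number of elements of T below v, whether v is in T) takes 7 values.
   Colouring T by this type under f_v gives a local colouring for H as soon as
   every ordering of V(H) has a vertex at which the edges of H have distinct types.
   Conversely, if k colours suffice and n exceeds the 4-uniform Ramsey number for
   k^16 colours (four vertices, four triples inside a 4-set), then on a homogeneous
   set f_v(T) depends only on the type of (v, T), so every ordering of V(H) has such
   a vertex.  The Erdos-Rado bound for that Ramsey number yields the rate.

   It remains to see that every ordering of H has such a vertex iff H is in calH.
   A vertex acts only through its code, the vector telling which edges contain it:
   with three edges, the few orderings without such a vertex all come from TP3, SP3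
   and LC3; with four edges, each of the 666 possible multisets of codes has an
   ordering without such a vertex.  Both facts are finite searches. *)
Require Import Defs.
From Stdlib Require Import Reals Lra Classical ClassicalDescription.
From mathcomp Require Import all_boot zify.
Set Implicit Arguments. Unset Strict Implicit. Unset Printing Implicit Defensive.

(** * Ramsey bounds on sequences *)

Lemma pigeonhole_filter (T : Type) (L : finType) (lab : T -> L) (l0 : L)
    (n : nat) (s : seq T) :
  #|L| * n <= size s -> exists l, n <= size [seq x <- s | lab x == l].
Proof.
case: n => [|n] hn; first by exists l0.
have sumE : \sum_(l : L) size [seq x <- s | lab x == l] = size s.
  elim: s {hn} => [|x s IH]; first by rewrite big1.
  rewrite [size _]/= -IH [in RHS](bigD1 (lab x)) //= (bigD1 (lab x)) //= eqxx -addSn.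
  by congr (_ + _); apply: eq_bigr => l; rewrite eq_sym => /negbTE ->.
case: (pickP (fun l => n < size [seq x <- s | lab x == l])) => [l hl|no].
  by exists l.
have : \sum_(l : L) size [seq x <- s | lab x == l] <= #|L| * n.
  by rewrite -sum_nat_const; apply: leq_sum => l _; rewrite leqNgt no.
rewrite sumE => h; have := leq_trans hn h.
have L0 : 0 < #|L| by apply/card_gt0P; exists l0.
by rewrite leq_pmul2l // ltnn.
Qed.

(* Erdos-Rado: grow [xs] by the first element x of the candidate list S, and keep
   those s in S for which the colours of the tuples (u, x, s), u in [xs], agree; [chi]
   records the colour of a tuple with its last element removed. *)
Lemma end_homogeneous (T : eqType) (C : finType) (r B M : nat)
    (c : seq T -> C) (xs S : seq T) (chi : seq T -> C) :
  (forall x u y, x \in S -> size u = r.+1 ->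
     subseq (rcons u y) (rcons xs x) -> c (rcons u y) = chi u) ->
  size xs + M <= B -> (1 + #|C| ^ (B ^ r)) ^ M <= size S ->
  exists ys chi', [/\ subseq ys S, size ys = M &
    forall u y, size u = r.+1 -> subseq (rcons u y) (xs ++ ys) ->
      c (rcons u y) = chi' u].
Proof.
elim: M xs S chi => [|M IH] xs S chi hchi hB.
  rewrite expn0; case: S hchi => // x S hchi _; exists [::], chi.
  split; rewrite ?sub0seq ?cats0 // => u y hu hs.
  by apply: (hchi x) => //; [exact: mem_head | exact: subseq_trans (subseq_rcons _ _)].
case: S hchi => [|x S] hchi hS; first by move: hS; rewrite leqn0 expn_eq0.
case: B IH hB hS => [|B] IH hB hS; first by rewrite addnS in hB.
(* Coding an [r]-tuple from [xs] by its positions bounds the number of colour patterns uniformly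
   over all stages. *)
pose vec u : r.-tuple 'I_B.+1 := [tuple inord (index (nth x u (i : 'I_r)) xs) | i < r].
have vecK u : size u = r -> subseq u xs -> [seq nth x xs (i : 'I_B.+1) | i <- vec u] = u.
  move=> hu hux; apply: (@eq_from_nth _ x); rewrite size_map size_tuple // => i hi.
  rewrite (nth_map ord0) ?size_tuple // -(tnth_nth ord0 (vec u) (Ordinal hi)) tnth_mktuple /=.
  have mem_i : nth x u i \in xs by apply: (mem_subseq hux); rewrite mem_nth ?hu.
  rewrite inordK ?nth_index //; apply: leq_ltn_trans (index_size _ _) _.
  by apply: leq_trans hB; rewrite addnS ltnS leq_addr.
pose lab s := [ffun tau : r.-tuple 'I_B.+1 =>
  c (rcons (rcons [seq nth x xs (i : 'I_B.+1) | i <- tau] x) s)].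
have [|l hl] := @pigeonhole_filter _ _ lab (lab x) ((1 + #|C| ^ (B.+1 ^ r)) ^ M) S.
  (* The summand 1 in the base pays for [x], which leaves the candidates. *)
  rewrite card_ffun card_tuple card_ord -ltnS; apply: leq_trans hS.
  by rewrite expnS mulnDl mul1n -add1n leq_add2r expn_gt0.
set S' := [seq s <- S | lab s == l] in hl.
(* Tuples inside [xs] keep their old colour; a new tuple ends in [x], and [l] holds its colour,
   indexed by what precedes [x]. *)
pose chi2 u := if subseq u xs then chi u else l (vec (take r u)).
have rcons_subseq (u v : seq T) y z : subseq (rcons u y) (rcons v z) =
    if y == z then subseq u v else subseq (rcons u y) v.
  rewrite -subseq_rev !rev_rcons /=.
  by case: eqP => _; rewrite -?rev_rcons subseq_rev.
have [s u y hs hu hsub|||ys [chi3 [h1 h2 h3]]] := IH (rcons xs x) S' chi2.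
- move: hs; rewrite mem_filter => /andP[/eqP ls hsS].
  move: hsub; rewrite rcons_subseq /chi2; case: eqVneq => [ys hux|_ hux].
    case: ifP => hu2.
      apply: (hchi s) => //; first by rewrite inE hsS orbT.
      by rewrite rcons_subseq ys eqxx.
    move: hu hux hu2; case/lastP: u => // u z; rewrite size_rcons => -[hu].
    rewrite rcons_subseq; case: eqVneq => [-> hux _|_ ->] //.
    have -> : take r (rcons u x) = u by rewrite -cats1 take_size_cat.
    by rewrite -ls ffunE vecK // ys.
  have -> : subseq u xs.
    by move: hux; rewrite rcons_subseq; case: eqP => // _; apply: subseq_trans (subseq_rcons _ _).
  by apply: (hchi x); rewrite ?mem_head.
- by rewrite size_rcons addSnnS.
- exact: hl.
exists (x :: ys), chi3; split; rewrite /= ?h2 //.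
  by rewrite eqxx; apply: subseq_trans h1 (filter_subseq _ _).
by move=> u y; rewrite -cat_rcons; apply: h3.
Qed.

(* [ramsey_bound r q t] is for colourings of (r+1)-subsets. *)
Fixpoint ramsey_bound (r q t : nat) : nat :=
  if r is r'.+1 then let M := ramsey_bound r' q t in (1 + q ^ (M ^ r')) ^ M
  else q * t.

(** On an end-homogeneous sequence the colour ignores the last element of a tuple, so induction
    applies to [chi], which colours tuples one shorter. *)
Lemma ramsey (T : eqType) (C : finType) (r t : nat) (c : seq T -> C) (s : seq T) :
  ramsey_bound r #|C| t <= size s ->
  exists s' col, [/\ subseq s' s, size s' = t &
    forall u, subseq u s' -> size u = r.+1 -> c u = col].
Proof.
elim: r c s => [|r IH] c s /= hs.
  have [|l hl] := @pigeonhole_filter _ _ (fun x => c [:: x]) (c [::]) t s; first exact: hs.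
  set s1 := [seq _ <- s | _] in hl; exists (take t s1), l; split.
  - by apply: subseq_trans (take_subseq _ _) (filter_subseq _ _).
  - by rewrite size_takel.
  case=> // x [] //; rewrite sub1seq => /mem_take.
  by rewrite mem_filter => /andP[/eqP].
have [x u y _ hu /size_subseq|||ys [chi [h1 h2 h3]]] :=
  @end_homogeneous _ _ r (ramsey_bound r #|C| t) (ramsey_bound r #|C| t) c [::] s (fun=> c [::]).
- by rewrite !size_rcons hu.
- exact: leqnn.
- exact: hs.
have [|s' [col [h4 h5 h6]]] := IH chi ys; first by rewrite h2.
exists s', col; split=> // [|u]; first exact: subseq_trans h4 h1.
case/lastP: u => // u y hu; rewrite size_rcons => -[hsz].
rewrite h3 //; last exact: subseq_trans hu h4.
by apply: h6 => //; apply: subseq_trans (subseq_rcons _ _) hu.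
Qed.

(** * Local colourings and order types *)

(** Orderings are given by rank functions into [nat], so an injection into ['I_n] followed by [val]
    is one. *)
Definition below (m : nat) (rho : 'I_m -> nat) (v : 'I_m) (e : {set 'I_m}) : nat :=
  #|[set w in e | rho w < rho v]|.

Definition separator (m : nat) (E : {set {set 'I_m}}) (rho : 'I_m -> nat) (v : 'I_m) : Prop :=
  forall e1 e2, e1 \in E -> e2 \in E ->
    below rho v e1 = below rho v e2 -> (v \in e1) = (v \in e2) -> e1 = e2.

Lemma card_below_imset (n m : nat) (phi : 'I_m -> 'I_n) (g : 'I_n -> nat)
    (v : 'I_m) (e : {set 'I_m}) : injective phi ->
  #|[set x in phi @: e | g x < g (phi v)]| = below (g \o phi) v e.
Proof.
move=> phi_inj; rewrite /below -(card_imset _ phi_inj); apply: eq_card => x.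
rewrite inE; apply/andP/imsetP => [[/imsetP[w we ->] lt]|[w]].
  by exists w; rewrite // inE we.
by rewrite inE => /andP[we lt] ->; rewrite imset_f.
Qed.

Lemma has_local_coloring_7 (n m : nat) (E : {set {set 'I_m}}) :
  (forall e, e \in E -> #|e| = 3) ->
  (forall rho : 'I_m -> nat, injective rho -> exists v, separator E rho v) ->
  has_local_coloring n 7 E.
Proof.
move=> HE sepE.
(* On a triple the count plus the membership bit is at most 3, so this code is at most 6. *)
exists (fun (v : 'I_n) (T : {set 'I_n}) =>
  inord (2 * #|[set w in T | val w < val v]| + (v \in T)) : 'I_7).
move=> phi phi_inj.
have [|v sepv] := sepE (val \o phi); first exact: inj_comp val_inj phi_inj.
exists v => e1 e2 he1 he2; rewrite !card_below_imset // !(mem_imset _ _ phi_inj).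
have bound e : e \in E -> 2 * below (val \o phi) v e + (v \in e) < 7.
  move=> /HE he; have : below (val \o phi) v e + (v \in e) <= 3.
    rewrite -he (cardsD1 v e) addnC leq_add2l; apply: subset_leq_card.
    apply/subsetP => w; rewrite !inE => /andP[-> lt]; rewrite andbT.
    by apply: contraTneq lt => ->; rewrite ltnn.
  by case: (v \in e); lia.
move/(congr1 val); rewrite /= !inordK ?bound // => eq.
have [eq1 eq2] : below (val \o phi) v e1 = below (val \o phi) v e2 /\ (v \in e1) = (v \in e2).
  by move: eq; case: (v \in e1); case: (v \in e2) => /=; lia.
by rewrite (sepv e1 e2).
Qed.

Lemma index_filter (T : eqType) (p : pred T) (s : seq T) (x : T) :
  p x -> x \in s -> index x (filter p s) = count p (take (index x s) s).
Proof.
move=> px; elim: s => //= y s IH; rewrite inE; case: eqVneq => [<- _|ne /= xs].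
  by rewrite px /= !eqxx.
rewrite -IH //; case: (p y) => //=; rewrite eq_sym (negbTE ne).
by [].
Qed.

(** Translates positions inside a 4-subset, which Ramsey sees, into the counts that define order
    types. *)
Lemma index_filter_card (T : finType) (A : {set T}) (s : seq T) (x : T) :
  uniq s -> {subset A <= s} -> x \in A ->
  index x (filter (mem A) s) = #|[set y in A | index y s < index x s]|.
Proof.
move=> us As xA; rewrite index_filter ?As // -size_filter.
rewrite -(card_uniqP _); last by rewrite filter_uniq // take_uniq.
apply: eq_card => y; rewrite inE mem_filter /=; case: (boolP (y \in A)) => //= yA.
by rewrite in_take ?As.
Qed.

(** On a homogeneous sequence of [m.+1] elements the first [m] carry a copy of [H] in the order
    [rho]; a vertex rainbow on this copy must tell the order types apart. *)
Lemma separator_of_local_coloring (n m k : nat) (E : {set {set 'I_m}}) :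
  (forall e, e \in E -> #|e| = 3) -> 0 < n ->
  has_local_coloring n k E -> ramsey_bound 3 (k ^ 16) m.+1 <= n ->
  forall rho : 'I_m -> nat, injective rho -> (forall v, rho v < m) ->
  exists v, separator E rho v.
Proof.
move=> HE n_gt0 [f fE] hn rho rho_inj rho_lt; pose x0 := Ordinal n_gt0.
(* Here [p.1] is the position of the viewing vertex and [p.2] that of the omitted one: 16 pairs,
   hence [k ^ 16] colours. *)
pose c (u : seq 'I_n) := [ffun p : 'I_4 * 'I_4 =>
  f (nth x0 u p.1) [set x in u | x != nth x0 u p.2]].
have [|s [col [s_sub s_size s_col]]] := @ramsey _ _ 3 m.+1 c (enum 'I_n).
  by rewrite card_ffun card_prod !card_ord size_enum_ord.
have us : uniq s := subseq_uniq s_sub (enum_uniq _).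
have color (A : {set 'I_n}) (v w : 'I_n) : {subset A <= s} -> #|A| = 4 -> v \in A -> w \in A ->
    f v (A :\ w) = col (inord #|[set x in A | index x s < index v s]|,
                        inord #|[set x in A | index x s < index w s]|).
  move=> As A4 vA wA; set u := filter (mem A) s.
  have mem_u x : (x \in u) = (x \in A).
    by rewrite mem_filter /=; case: (boolP (x \in A)) => //= xA; rewrite As.
  have u4 : size u = 4.
    by rewrite -A4 -(card_uniqP (filter_uniq _ us)); apply: eq_card.
  rewrite -!index_filter_card // -/u -(s_col u) ?filter_subseq // ffunE /=.
  have idx x : x \in A -> index x u < 4 by rewrite -mem_u -u4 index_mem.
  rewrite !inordK ?idx // !nth_index ?mem_u //; congr f.
  by apply/setP => x; rewrite !inE mem_u andbC.
pose phi v := nth x0 s (rho v); pose z := nth x0 s m.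
have rho_s v : rho v < size s by rewrite s_size ltnW // ltnS.
have phi_inj : injective phi.
  by move=> v w /eqP; rewrite nth_uniq // => /eqP/rho_inj.
have idx_phi v : index (phi v) s = rho v by rewrite index_uniq.
have idx_z : index z s = m by rewrite index_uniq // s_size.
have phi_s v : phi v \in s by rewrite mem_nth.
(* The last element z of [s] completes phi(e) to a 4-set when v is in e. *)
have [v rv] := fE phi phi_inj; exists v => e1 e2 he1 he2 eb ev.
apply: (imset_inj phi_inj); apply: rv => //.
have belowE (e : {set 'I_m}) : #|[set x in phi @: e | index x s < index (phi v) s]| = below rho v e.
  rewrite (card_below_imset (fun x => index x s)) // /below.
  by apply: eq_card => w; rewrite !inE /= !idx_phi.
suff fcol (e : {set 'I_m}) : e \in E -> f (phi v) (phi @: e) =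
    col (inord (below rho v e), inord (if v \in e then 3 else below rho v e)).
  by rewrite !fcol // eb ev.
(* When [v] lies outside [e], the fourth element is [phi v] itself, so the omitted position is that
   of [phi v]. *)
move=> he; pose w := if v \in e then z else phi v.
have z_phi x : z != phi x.
  apply/eqP => /(congr1 (index^~ s)); rewrite idx_z idx_phi => eq.
  by move: (rho_lt x); rewrite -eq ltnn.
have w_e : w \notin phi @: e.
  rewrite /w; case: ifP => ve; last by rewrite mem_imset ?ve.
  by apply/imsetP => -[x _ /eqP]; apply/negP.
have -> : phi @: e = (w |: phi @: e) :\ w by rewrite setU1K.
have card_below_w x : index x s <= index w s ->
    [set y in w |: phi @: e | index y s < index x s] =
    [set y in phi @: e | index y s < index x s].
  move=> le; apply/setP => y; rewrite !inE; case: eqP => //= ->.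
  by rewrite ltnNge le andbF.
rewrite color; first last.
- by rewrite setU11.
- by rewrite in_setU1 mem_imset // /w; case: ifP => [_|]; rewrite ?eqxx ?orbT.
- by rewrite cardsU1 w_e card_imset // HE.
- move=> x; rewrite in_setU1 => /orP[/eqP ->|/imsetP[y _ ->]] //.
  by rewrite /w; case: ifP => // _; rewrite mem_nth // s_size.
rewrite !card_below_w //; last first.
  by rewrite /w; case: ifP => // _; rewrite idx_phi idx_z ltnW.
rewrite belowE /w; case: ifP => ve; last by rewrite belowE.
congr (col (_, inord _)); rewrite -(HE e he) -(card_imset _ phi_inj).
apply: eq_card => y; rewrite inE; case: (boolP (y \in phi @: e)) => // /imsetP[x _ ->].
by rewrite idx_phi idx_z rho_lt.
Qed.

Lemma has_lcbP (n m k : nat) (E : {set {set 'I_m}}) :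
  reflect (has_local_coloring n k E) (has_lcb n E k).
Proof.
by rewrite /has_lcb; case: excluded_middle_informative => h; constructor.
Qed.

Lemma C3_spec (n m k : nat) (E : {set {set 'I_m}}) :
  has_local_coloring n k E -> has_local_coloring n (C3 n E) E /\ C3 n E <= k.
Proof.
move=> hk; rewrite /C3.
case: excluded_middle_informative => [h|[]]; last by exists k; apply/has_lcbP.
by case: ex_minnP => j /has_lcbP hj jmin; split=> //; apply/jmin/has_lcbP.
Qed.

(** Makes the minimum in [C3] range over a nonempty set. *)
Lemma has_local_coloring_rainbow (n m : nat) (E : {set {set 'I_m}}) :
  0 < m -> has_local_coloring n #|{set 'I_n}| E.
Proof.
move=> m_gt0; exists (fun _ T => enum_rank T) => phi _.
by exists (Ordinal m_gt0) => e1 e2 _ _ /enum_rank_inj.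
Qed.

(** * Vertex orderings and vertex codes *)

Definition code (m : nat) (es : seq {set 'I_m}) (v : 'I_m) : bitseq :=
  [seq v \in (e : {set 'I_m}) | e <- es].
(** Isolated vertices have zero code and change no count, so the searches only need the remaining
    ones. *)
Definition covered (m : nat) (es : seq {set 'I_m}) : seq 'I_m :=
  [seq v <- enum 'I_m | has id (code es v)].

(** Column [i] of [P] counts the vertices of edge [i] already placed, so the listed pairs are the
    order types of the edges at the next vertex. *)
Definition separates (k : nat) (P : seq bitseq) (d : bitseq) : bool :=
  uniq [seq (count (fun c => nth false c i) P, nth false d i) | i <- iota 0 k].

(* No vertex of the ordering with codes L separates the edges; P is the list of the
   codes placed before L, the most recent first. *)
Fixpoint stuck (k : nat) (P L : seq bitseq) : bool :=
  if L is d :: L' then ~~ separates k P d && stuck k (d :: P) L' else true.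

Fixpoint codes (k : nat) : seq bitseq :=
  if k is k'.+1 then map (cons true) (codes k') ++ map (cons false) (codes k')
  else [:: [::]].
Definition nzcodes k := [seq d <- codes k | has id d].

Definition degrees (k : nat) (P : seq bitseq) : seq nat :=
  [seq count (fun c => nth false c i) P | i <- iota 0 k].
(** Equal columns mean equal edges, so a list with a repetition comes from no set of distinct
    edges. *)
Definition repeated_column (k : nat) (P : seq bitseq) : bool :=
  has (fun i => has (fun j => (i != j) && all (fun d => nth false d i == nth false d j) P)
     (iota 0 k)) (iota 0 k).

(* Unlike [has], this stops at the first success under call-by-value reduction. *)
Fixpoint short_has (T : Type) (p : pred T) (s : seq T) : bool :=
  if s is x :: s' then if p x then true else short_has p s' else false.

(** Backtracking over the permutations of [L]. Exhausted fuel [n] gives [false], so an answer [true]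
    is always sound. *)
Fixpoint reorder_stuck (k n : nat) (P L : seq bitseq) : bool :=
  if n is n'.+1 then
    if L is [::] then true else
    short_has (fun d => if separates k P d then false
                        else reorder_stuck k n' (d :: P) (rem d L)) L
  else false.

(* In this search and the next one, n is fuel, and the result is [false] when it runs
   out.  [P] is extended by elements of [cs] in all ways giving every edge three
   vertices. *)
Fixpoint all_degree3 (k n : nat) (Q : pred (seq bitseq)) (cs P : seq bitseq) : bool :=
  if n is n'.+1 then
    if degrees k P == nseq k 3 then Q P else
    if cs is d :: cs' then
       (if all (leq^~ 3) (degrees k (d :: P)) then all_degree3 k n' Q cs (d :: P) else true)
       && all_degree3 k n' Q cs' P
    else true
  else false.

Fixpoint all_stuck3 (k n : nat) (Q : pred (seq bitseq)) (P : seq bitseq) : bool :=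
  if n is n'.+1 then
    if degrees k P == nseq k 3 then Q P else
    all (fun d => if ~~ separates k P d && all (leq^~ 3) (degrees k (d :: P))
                  then all_stuck3 k n' Q (d :: P) else true) (nzcodes k)
  else false.


(** * Soundness of the searches *)

Lemma short_hasE (T : Type) (p : pred T) (s : seq T) : short_has p s = has p s.
Proof. by elim: s => //= x s ->. Qed.

Lemma mem_codes (k : nat) (d : bitseq) : (d \in codes k) = (size d == k).
Proof.
elim: k d => [|k IH] [|b d] //=; rewrite mem_cat.
  by apply/norP; split; apply/mapP => -[].
by rewrite eqSS -IH; case: b; rewrite ?(mem_map (f := cons true)) ?(mem_map (f := cons false));
  try (by move=> ? ? []); apply/idP/idP => [/orP[]|->] //; rewrite ?orbT // => /mapP[].
Qed.

Lemma mem_nzcodes (k : nat) (d : bitseq) : (d \in nzcodes k) = has id d && (size d == k).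
Proof. by rewrite mem_filter mem_codes. Qed.

Lemma degrees_perm (k : nat) (P P' : seq bitseq) :
  perm_eq P P' -> degrees k P = degrees k P'.
Proof. by move=> /permP eqP'; apply: eq_map => j; apply: eqP'. Qed.

Lemma degrees_eq3P (k : nat) (P : seq bitseq) :
  reflect (forall j, j < k -> count (fun c => nth false c j) P = 3)
          (degrees k P == nseq k 3).
Proof.
apply: (iffP eqP) => [eq j jk|deg].
  have := congr1 (fun s => nth 0 s j) eq.
  by rewrite nth_nseq jk (nth_map 0) ?size_iota // nth_iota.
apply: (@eq_from_nth _ 0); rewrite size_map size_iota ?size_nseq // => j jk.
by rewrite nth_nseq jk (nth_map 0) ?size_iota // nth_iota // deg.
Qed.

Lemma degrees_le3 (k : nat) (P P' : seq bitseq) :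
  degrees k (P' ++ P) = nseq k 3 -> all (leq^~ 3) (degrees k P).
Proof.
move=> /eqP/degrees_eq3P deg; apply/allP => x /mapP[j]; rewrite mem_iota /= add0n => jk ->.
by rewrite -(deg j jk) count_cat leq_addl.
Qed.

(** Any further nonzero code would push some degree above 3. *)
Lemma degrees3_nzcodes_nil (k : nat) (L P : seq bitseq) : {subset L <= nzcodes k} ->
  degrees k P = nseq k 3 -> degrees k (L ++ P) = nseq k 3 -> L = [::].
Proof.
case: L => // d L Lk /eqP/degrees_eq3P degP /eqP/degrees_eq3P deg.
have := Lk d (mem_head _ _); rewrite mem_nzcodes => /andP[/(has_nthP false)[j jd dj] /eqP sd].
rewrite sd in jd; have := deg j jd; rewrite /= in dj; rewrite /= dj count_cat degP //; lia.
Qed.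

Lemma reorder_stuckP (k n : nat) (P L : seq bitseq) :
  reorder_stuck k n P L -> exists2 t, perm_eq t L & stuck k P t.
Proof.
elim: n P L => //= n IH P [|d0 L0]; first by exists [::].
rewrite short_hasE; move: (d0 :: L0) => L /hasP[d dL].
case: ifP => // sepF /IH[t pt st]; exists (d :: t); last by rewrite /= sepF.
by rewrite perm_sym (perm_trans (perm_to_rem dL)) // perm_cons perm_sym.
Qed.

(** The two branches answer whether [d] still occurs in [L]: if so, one copy moves to [P]; otherwise
    [d] is discarded. Only the multiset is tracked, hence the permutation [t]. *)
Lemma all_degree3P (k n : nat) (Q : pred (seq bitseq)) (cs P L : seq bitseq) :
  all_degree3 k n Q cs P -> {subset cs <= nzcodes k} -> {subset L <= cs} ->
  degrees k (L ++ P) = nseq k 3 -> exists2 t, perm_eq t (L ++ P) & Q t.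
Proof.
elim: n cs P L => //= n IH cs P L; case: eqP => [degP QP csk Lcs deg|ndegP].
  exists P => //; rewrite (degrees3_nzcodes_nil _ degP deg) // => d /Lcs; exact: csk.
case: cs => [|d cs] H csk Lcs deg.
  by case: L Lcs deg => [_ /ndegP //|d L /(_ d (mem_head _ _))].
case/andP: H => Hin Hout; case: (boolP (d \in L)) => [dL|dL]; last first.
  apply: (IH cs) => // [x xcs|x xL]; first by apply: csk; rewrite inE xcs orbT.
  by have := Lcs x xL; rewrite inE => /orP[/eqP xd|//]; rewrite -xd xL in dL.
have pL : perm_eq (rem d L ++ d :: P) (L ++ P).
  by rewrite -cat_rcons perm_cat2r perm_rcons perm_sym perm_to_rem.
have deg' : degrees k (rem d L ++ d :: P) = nseq k 3 by rewrite (degrees_perm _ pL).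
rewrite (degrees_le3 deg') in Hin.
have [x /mem_rem/Lcs //||t pt Qt] := IH _ _ (rem d L) Hin csk.
  exact: deg'.
by exists t => //; apply: perm_trans pt pL.
Qed.

(** [L] itself is a branch of the search: being stuck passes the first test and the final degrees
    pass the second. The newest code stands first, hence [rev L]. *)
Lemma all_stuck3P (k n : nat) (Q : pred (seq bitseq)) (P L : seq bitseq) :
  all_stuck3 k n Q P -> {subset L <= nzcodes k} -> stuck k P L ->
  degrees k (L ++ P) = nseq k 3 -> Q (rev L ++ P).
Proof.
elim: n P L => //= n IH P L; case: eqP => [degP QP Lk _ deg|ndegP].
  by rewrite (degrees3_nzcodes_nil Lk degP deg).
case: L => [_ _ _ /ndegP //|d L] H Lk /= /andP[sepF st] deg.
have pL : perm_eq (L ++ d :: P) (d :: L ++ P).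
  by rewrite -cat_rcons -cat_cons perm_cat2r perm_rcons.
have deg' : degrees k (L ++ d :: P) = nseq k 3 by rewrite (degrees_perm _ pL).
have := allP H d (Lk _ (mem_head _ _)); rewrite sepF (degrees_le3 deg') /= => H'.
rewrite rev_cons cat_rcons; apply: IH => // x xL.
by apply: Lk; rewrite inE xL orbT.
Qed.

Lemma stuck_cat (k : nat) (P L1 L2 : seq bitseq) :
  stuck k P (L1 ++ L2) = stuck k P L1 && stuck k (rev L1 ++ P) L2.
Proof.
by elim: L1 P => //= d L1 IH P; rewrite IH rev_cons cat_rcons andbA.
Qed.

(** A zero code leaves every column count unchanged, and [separates] sees [P] only through these
    counts. *)
Lemma stuck_filter (k : nat) (P P' L : seq bitseq) :
  degrees k P = degrees k P' -> stuck k P L -> stuck k P' (filter (has id) L).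
Proof.
move=> degE; have cntE d : forall (P P' : seq bitseq), degrees k P = degrees k P' ->
    degrees k (d :: P) = degrees k (d :: P').
  move=> P1 P2 /eq_in_map eqP12; apply/eq_in_map => j jk /=; congr (_ + _); exact: eqP12.
elim: L P P' degE => //= d L IH P P' degE /andP[sepF st].
case: ifP => [_|nz] /=; last first.
  apply: IH st; rewrite -degE; apply: eq_map => j /=.
  by move/hasPn: (negbT nz) => nz'; rewrite (_ : nth false d j = false) //;
    case: (ltnP j (size d)) => jd; [apply: negbTE (nz' _ (mem_nth _ jd)) | rewrite nth_default].
rewrite (IH _ _ (cntE _ _ _ degE) st) andbT; apply: contraNN sepF; congr uniq.
by apply/eq_in_map => j jk; congr pair; move/eq_in_map: degE => ->.
Qed.

(** * Codes along a vertex ordering *)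

Lemma nth_code (m : nat) (es : seq {set 'I_m}) (v : 'I_m) (j : nat) :
  j < size es -> nth false (code es v) j = (v \in nth set0 es j).
Proof. by move=> jk; rewrite (nth_map set0). Qed.

Lemma count_code (m : nat) (es : seq {set 'I_m}) (s : seq 'I_m) (j : nat) :
  j < size es ->
  count (fun c => nth false c j) (map (code es) s) = count (mem (nth set0 es j)) s.
Proof. by move=> jk; rewrite count_map; apply: eq_count => v /=; rewrite nth_code. Qed.

(** In a list sorted by rank the vertices below [v] are exactly those of [p]. *)
Lemma separates_code (m : nat) (es : seq {set 'I_m}) (rho : 'I_m -> nat)
    (s p q : seq 'I_m) (v : 'I_m) :
  uniq s -> (forall w, w \in s) -> (forall w v, (rho w < rho v) = (index w s < index v s)) ->
  s = p ++ v :: q ->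
  separates (size es) (rev (map (code es) p)) (code es v) =
  uniq [seq (below rho v e, v \in e) | e <- es].
Proof.
move=> us s_all rhoE sE; congr uniq.
apply: (@eq_from_nth _ (0, false)); rewrite !size_map size_iota // => j jk.
rewrite (nth_map 0) ?size_iota // (nth_map set0) // nth_iota // add0n nth_code //.
congr pair; rewrite count_rev count_code // /below -size_filter.
have up : uniq p by move: us; rewrite sE cat_uniq => /andP[].
have idx_v : index v s = size p.
  move: us; rewrite sE cat_uniq index_cat /= eqxx addn0 => /and3P[_ /norP[vp _] _].
  by rewrite (negbTE vp).
rewrite -(card_uniqP (filter_uniq _ up)); apply: eq_card => w.
rewrite mem_filter !inE rhoE idx_v -(in_take _ (s_all w)) sE take_size_cat //.
Qed.

Lemma separator_uniq (m : nat) (E : {set {set 'I_m}}) (es : seq {set 'I_m})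
    (rho : 'I_m -> nat) (v : 'I_m) : uniq es -> {subset es <= E} ->
  separator E rho v -> uniq [seq (below rho v e, v \in e) | e <- es].
Proof.
move=> ues esE sepv; rewrite map_inj_in_uniq // => e1 e2 he1 he2 [eb ev].
by apply: sepv => //; apply: esE.
Qed.

Lemma uniq_separator (m : nat) (E : {set {set 'I_m}}) (es : seq {set 'I_m})
    (rho : 'I_m -> nat) (v : 'I_m) : {subset E <= es} ->
  uniq [seq (below rho v e, v \in e) | e <- es] -> separator E rho v.
Proof.
move=> Ees ut e1 e2 /Ees he1 /Ees he2 eb ev.
rewrite -(nth_index set0 he1) -(nth_index set0 he2); congr nth; apply/eqP.
rewrite -(nth_uniq (0, false) _ _ ut) ?size_map ?index_mem //.
by rewrite !(nth_map set0) ?index_mem // !nth_index // eb ev.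
Qed.

Lemma stuck_of_no_separator (m : nat) (E : {set {set 'I_m}}) (es : seq {set 'I_m})
    (rho : 'I_m -> nat) : {subset E <= es} -> injective rho ->
  (forall v, ~ separator E rho v) ->
  exists2 s, perm_eq s (enum 'I_m) & stuck (size es) [::] (map (code es) s).
Proof.
move=> Ees rho_inj nosep; pose leT := [rel v w : 'I_m | rho v <= rho w].
pose s := sort leT (enum 'I_m).
have ps : perm_eq s (enum 'I_m) by rewrite perm_sort.
have us : uniq s by rewrite sort_uniq enum_uniq.
have s_all w : w \in s by rewrite mem_sort mem_enum.
have s_sorted : sorted leT s by apply: sort_sorted => v w; exact: leq_total.
have leT_tr : transitive leT by move=> ? ? ?; exact: leq_trans.
have lt_le w v : index w s < index v s -> rho w <= rho v.
  exact: (sorted_ltn_index leT_tr s_sorted).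
have rhoE w v : (rho w < rho v) = (index w s < index v s).
  case: (ltngtP (index w s) (index v s)) => [lt|gt|eq].
  - rewrite ltn_neqAle lt_le // andbT; apply: contraTneq lt => /rho_inj ->.
    by rewrite ltnn.
  - by rewrite ltnNge lt_le.
  by rewrite (index_inj w (s_all w) (s_all v) eq) ltnn.
exists s => //.
suff H q p : s = p ++ q -> stuck (size es) (rev (map (code es) p)) (map (code es) q).
  exact: (H s [::]).
elim: q p => //= v q IH p sE; apply/andP; split.
  apply/negP; rewrite (separates_code es us s_all rhoE sE).
  by move/(uniq_separator Ees)/nosep.
by rewrite -rev_rcons -map_rcons; apply: IH; rewrite cat_rcons.
Qed.

(** Vertices missing from [s] are placed last; there all edges are complete and avoid the vertex, so
    they share one type. A separator for [E] would also separate the subfamily [es]. *)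
Lemma no_separator_of_stuck (m : nat) (E : {set {set 'I_m}}) (es : seq {set 'I_m})
    (s : seq 'I_m) :
  uniq es -> {subset es <= E} -> 1 < size es -> (forall e, e \in es -> #|e| = 3) ->
  uniq s -> (forall e, e \in es -> {subset e <= s}) ->
  stuck (size es) [::] (map (code es) s) ->
  exists rho : 'I_m -> nat, [/\ injective rho, forall v, rho v < m &
    forall v, ~ separator E rho v].
Proof.
move=> ues esE es1 card_es us s_cov st.
pose s' := s ++ [seq v <- enum 'I_m | v \notin s].
have us' : uniq s'.
  rewrite cat_uniq us filter_uniq ?enum_uniq // andbT.
  by apply/hasPn => v; rewrite mem_filter => /andP[].
have s'_all w : w \in s'.
  by rewrite mem_cat mem_filter mem_enum andbT orbN.
have size_s' : size s' = m.
  by rewrite -[RHS]card_ord -(card_uniqP us'); apply: eq_card => w; rewrite s'_all.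
have st' : stuck (size es) [::] (map (code es) s').
  rewrite map_cat stuck_cat st cats0.
  set P := rev _; have : forall j, j < size es -> count (fun c => nth false c j) P = 3.
    move=> j jk; have ej := mem_nth set0 jk.
    rewrite count_rev count_code // -(card_es _ ej) -size_filter.
    rewrite -(card_uniqP (filter_uniq _ us)); apply: eq_card => w; rewrite mem_filter /=.
    by case: (boolP (w \in nth set0 es j)) => //= /(s_cov _ ej).
  have : all (fun v => v \notin s) [seq v <- enum 'I_m | v \notin s] by apply: filter_all.
  elim: (filter _ _) P => //= v q IH P /andP[vs qs] degP.
  have v0 j : j < size es -> nth false (code es v) j = false.
    move=> jk; rewrite nth_code //; apply: contraNF vs; exact/s_cov/mem_nth.
  rewrite IH ?andbT // => [|j jk]; last by rewrite /= v0 // degP.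
  (* Columns 0 and 1, available since [es] has at least two edges, both give the pair
     [(3, false)]. *)
  apply/negP => /uniqP - /(_ (0, false) 0 1).
  rewrite !inE size_map size_iota; case: (size es) es1 degP v0 => [|[|k]] //= _ degP v0.
  by rewrite !degP // !v0 // => /(_ isT isT erefl).
exists (fun v => index v s'); split=> [v w|v|v sepv].
- by apply: (index_inj v).
- by apply: leq_trans (eq_leq size_s'); rewrite index_mem.
have vs' := s'_all v; have := st'.
rewrite -(cat_take_drop (index v s') s') (drop_nth v) ?index_mem // nth_index //.
rewrite map_cat stuck_cat cats0 => /andP[_ /= /andP[+ _]].
rewrite (@separates_code _ es (fun v => index v s') s' _ (drop (index v s').+1 s')) //.
  by rewrite (separator_uniq ues esE sepv).
by rewrite -{1}(cat_take_drop (index v s') s') (drop_nth v) ?index_mem // nth_index.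
Qed.

(** Turns an arrangement of codes found by a search into an arrangement of vertices. *)
Lemma perm_map_lift (T1 T2 : eqType) (f : T1 -> T2) (s : seq T1) (t : seq T2) :
  perm_eq t (map f s) -> exists2 s', perm_eq s' s & map f s' = t.
Proof.
case: s => [|x s]; first by move=> /perm_nilP ->; exists [::].
move=> /(perm_iotaP (f x))[Is pIs tE].
exists (map (nth x (x :: s)) Is).
  by apply/(perm_iotaP x); exists Is => //; rewrite -(size_map f).
rewrite tE -map_comp; apply/eq_in_map => j /=.
rewrite (perm_mem pIs) mem_iota /= add0n size_map => jk.
by rewrite -map_cons (nth_map x).
Qed.

Lemma covered_uniq (m : nat) (es : seq {set 'I_m}) : uniq (covered es).
Proof. by rewrite filter_uniq // enum_uniq. Qed.

Lemma mem_covered (m : nat) (es : seq {set 'I_m}) (e : {set 'I_m}) :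
  e \in es -> {subset e <= covered es}.
Proof.
move=> ees v ve; rewrite mem_filter mem_enum andbT has_map.
by apply/hasP; exists e.
Qed.

Lemma code_covered_nz (m : nat) (es : seq {set 'I_m}) :
  {subset map (code es) (covered es) <= nzcodes (size es)}.
Proof.
move=> d /mapP[v]; rewrite mem_filter => /andP[nz _] ->.
by rewrite mem_nzcodes nz size_map eqxx.
Qed.

Lemma degrees_covered (m : nat) (es : seq {set 'I_m}) (s : seq 'I_m) :
  (forall e, e \in es -> #|e| = 3) -> uniq s -> (forall e, e \in es -> {subset e <= s}) ->
  degrees (size es) (map (code es) s) = nseq (size es) 3.
Proof.
move=> card_es us cov; apply/eqP/degrees_eq3P => j jk; have ej := mem_nth set0 jk.
rewrite count_code // -(card_es _ ej) -size_filter -(card_uniqP (filter_uniq _ us)).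
apply: eq_card => w; rewrite mem_filter /=.
by case: (boolP (w \in nth set0 es j)) => //= /(cov _ ej).
Qed.

Lemma repeated_columnF (m : nat) (es : seq {set 'I_m}) (s : seq 'I_m) (P : seq bitseq) :
  uniq es -> (forall e, e \in es -> {subset e <= s}) ->
  perm_eq P (map (code es) s) -> repeated_column (size es) P = false.
Proof.
move=> ues cov pP; apply/hasP => -[i]; rewrite mem_iota /= add0n => ik /hasP[j].
rewrite mem_iota /= add0n => jk /andP[ij /allP eqc]; case/negP: ij.
rewrite -(nth_uniq set0 ik jk ues); apply/eqP/setP => v.
case: (boolP (v \in s)) => vs.
  have := eqc (code es v); rewrite (perm_mem pP) map_f // !nth_code //.
  by move=> /(_ isT)/eqP.
have out l : l < size es -> v \in nth set0 es l = false.
  by move=> lk; apply: contraNF vs; apply/cov/mem_nth.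
by rewrite !out.
Qed.

Lemma uniq_of_columns (m : nat) (es : seq {set 'I_m}) (s : seq 'I_m) :
  ~~ repeated_column (size es) (map (code es) s) -> uniq es.
Proof.
apply: contraNT => /(uniqPn set0)[i [j [ij jk eq]]].
have ik := ltn_trans ij jk; apply/hasP; exists i; rewrite ?mem_iota //.
apply/hasP; exists j; rewrite ?mem_iota // (ltn_eqF ij) /=.
by apply/allP => _ /mapP[v _ ->]; rewrite !nth_code // eq.
Qed.

(** * Four edges *)

(** The degrees sum to 12, so a path makes at most 12 additions and 15 discards of codes: 28 calls
    with the last one. At most 12 codes are then reordered, in 13 nested calls. *)
Lemma four_edges_codes :
  all_degree3 4 28 (fun P => if repeated_column 4 P then true else reorder_stuck 4 13 [::] P)
    (nzcodes 4) [::].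
Proof. by vm_compute. Qed.

Lemma four_edges_stuck (m : nat) (es : seq {set 'I_m}) :
  size es = 4 -> uniq es -> (forall e, e \in es -> #|e| = 3) ->
  exists s, [/\ uniq s, forall e, e \in es -> {subset e <= s} &
    stuck (size es) [::] (map (code es) s)].
Proof.
move=> es4 ues card_es; have nz := @code_covered_nz _ es.
have deg := degrees_covered card_es (covered_uniq es) (@mem_covered _ es).
have [||t] := all_degree3P (L := map (code es) (covered es)) four_edges_codes (fun _ => id).
- by rewrite -es4.
- by rewrite cats0 -es4.
rewrite cats0 => pt; rewrite -es4 (repeated_columnF ues (@mem_covered _ es) pt).
move=> /reorder_stuckP[t' pt' st].
have [s ps sE] := perm_map_lift (perm_trans pt' pt).
exists s; split; rewrite ?sE //; first by rewrite (perm_uniq ps) covered_uniq.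
by move=> e ee v ve; rewrite (perm_mem ps) (mem_covered ee).
Qed.

(** * The three exceptional 3-graphs *)

(** Literals, so that the searches compute; [code_TP3] and its companions tie them to the edges. *)
Definition TP3codes : seq bitseq :=
  [:: [:: true; false; false]; [:: true; true; false]; [:: true; true; true];
      [:: false; true; true]; [:: false; false; true]].
Definition SP3codes : seq bitseq :=
  [:: [:: true; false; false]; [:: true; true; false]; [:: true; true; false];
      [:: false; true; true]; [:: false; false; true]; [:: false; false; true]].
Definition LC3codes : seq bitseq :=
  [:: [:: true; false; true]; [:: true; true; false]; [:: false; true; true];
      [:: true; false; false]; [:: false; true; false]; [:: false; false; true]].
(** Lists, since a code depends on the order of the edges. *)
Definition TP3edges : seq {set 'I_5} :=
  [:: [set inord 0; inord 1; inord 2]; [set inord 1; inord 2; inord 3];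
      [set inord 2; inord 3; inord 4]].
Definition SP3edges : seq {set 'I_6} :=
  [:: [set inord 0; inord 1; inord 2]; [set inord 1; inord 2; inord 3];
      [set inord 3; inord 4; inord 5]].
Definition LC3edges : seq {set 'I_6} :=
  [:: [set inord 0; inord 1; inord 3]; [set inord 1; inord 2; inord 4];
      [set inord 0; inord 2; inord 5]].

Lemma TP3E : TP3 = [set e in TP3edges].
Proof. by apply/setP => e; rewrite !inE orbA. Qed.
Lemma SP3E : SP3 = [set e in SP3edges].
Proof. by apply/setP => e; rewrite !inE orbA. Qed.
Lemma LC3E : LC3 = [set e in LC3edges].
Proof. by apply/setP => e; rewrite !inE orbA. Qed.

Lemma map_enum_inord (T : Type) (p : nat) (F : 'I_p.+1 -> T) :
  map F (enum 'I_p.+1) = map (fun j => F (inord j)) (iota 0 p.+1).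
Proof.
by rewrite -val_enum_ord -map_comp; apply: eq_map => j /=; rewrite inord_val.
Qed.

Lemma code_TP3 : map (code TP3edges) (enum 'I_5) = TP3codes.
Proof. by rewrite map_enum_inord /= /code /= !inE -!val_eqE /= !inordK. Qed.
Lemma code_SP3 : map (code SP3edges) (enum 'I_6) = SP3codes.
Proof. by rewrite map_enum_inord /= /code /= !inE -!val_eqE /= !inordK. Qed.
Lemma code_LC3 : map (code LC3edges) (enum 'I_6) = LC3codes.
Proof. by rewrite map_enum_inord /= /code /= !inE -!val_eqE /= !inordK. Qed.

(** Isomorphism on the level of codes: [pi] reorders the edges and [perm_eq] the vertices. *)
Definition has_codes (X P : seq bitseq) : bool :=
  has (fun pi => perm_eq X [seq [seq nth false d j | j <- pi] | d <- P])
      (permutations (iota 0 3)).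

(** Three edges cover at most 9 vertices, hence the fuel 10. *)
Lemma three_edges_codes :
  all_stuck3 3 10 (fun P => [|| repeated_column 3 P, has_codes TP3codes P,
                                has_codes SP3codes P | has_codes LC3codes P]) [::].
Proof. by vm_compute. Qed.

Lemma isolated_codes_stuck :
  all (fun X => ~~ repeated_column 3 X && reorder_stuck 3 7 [::] X)
      [:: TP3codes; SP3codes; LC3codes].
Proof. by vm_compute. Qed.

(** Membership can be read off the codes, so matching positions matches edges; as [vs] covers the
    edges, none of their vertices is missed. *)
Lemma embedding_of_codes (p m : nat) (xs : seq {set 'I_p}) (es : seq {set 'I_m})
    (vs : seq 'I_m) (v0 : 'I_m) :
  size es = size xs -> uniq vs -> (forall e, e \in es -> {subset e <= vs}) ->
  map (code es) vs = map (code xs) (enum 'I_p) ->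
  exists2 psi : 'I_p -> 'I_m, injective psi & es = [seq psi @: x | x : {set 'I_p} <- xs].
Proof.
move=> size_es uvs cov codeE.
have size_vs : size vs = p by rewrite -(size_map (code es)) codeE size_map size_enum_ord.
pose psi (l : 'I_p) := nth v0 vs l.
have psi_inj : injective psi.
  by move=> l l' /eqP; rewrite nth_uniq ?size_vs // => /eqP/val_inj.
exists psi => //; apply: (@eq_from_nth _ set0); rewrite ?size_map // => j jk.
have jx : j < size xs by rewrite -size_es.
have psiE l : (psi l \in nth set0 es j) = (l \in nth set0 xs j).
  rewrite -!nth_code //; congr nth; have := congr1 (fun s => nth [::] s l) codeE.
  by rewrite (nth_map v0) ?size_vs // (nth_map l) ?size_enum_ord // nth_ord_enum.
rewrite (nth_map set0) //; apply/setP => v; apply/idP/imsetP => [ve|[l lx ->]].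
  have vvs := cov _ (mem_nth set0 jk) _ ve.
  have lt : index v vs < p by rewrite -size_vs index_mem.
  have vE : v = psi (Ordinal lt) by rewrite /psi /= nth_index.
  by exists (Ordinal lt); rewrite // -psiE -vE.
by rewrite psiE.
Qed.

Lemma adds_isolated_of_codes (p m : nat) (X : {set {set 'I_p}}) (xs : seq {set 'I_p})
    (E : {set {set 'I_m}}) (es : seq {set 'I_m}) (v0 : 'I_m) (P : seq bitseq) :
  X = [set e in xs] -> E = [set e in es] -> size xs = 3 -> size es = 3 ->
  perm_eq P (map (code es) (covered es)) ->
  has_codes (map (code xs) (enum 'I_p)) P -> adds_isolated X E.
Proof.
move=> XE EE xs3 es3 pP /hasP[pi]; rewrite mem_permutations => p_pi pX.
(* The edges of [E] come in arbitrary order; [pi] aligns them with those of [xs]. *)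
pose es' := [seq nth set0 es j | j <- pi].
have p_es' : perm_eq es' es by apply/(perm_iotaP set0); exists pi; rewrite ?es3.
have codeE v : code es' v = [seq nth false (code es v) j | j <- pi].
  rewrite /code -map_comp; apply/eq_in_map => j; rewrite (perm_mem p_pi) mem_iota /= => jk.
  by rewrite nth_code // es3.
have : perm_eq (map (code xs) (enum 'I_p)) (map (code es') (covered es)).
  apply: perm_trans pX _; rewrite (eq_map codeE).
  rewrite (map_comp (fun d : bitseq => [seq nth false d j | j <- pi]) (code es)).
  exact: perm_map.
move=> /perm_map_lift[vs pvs vsE].
have [|||psi psi_inj es'E] := embedding_of_codes (es := es') (xs := xs) v0 _ _ _ vsE.
- by rewrite (perm_size p_es') es3 xs3.
- by rewrite (perm_uniq pvs) covered_uniq.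
- by move=> e; rewrite (perm_mem p_es') => ee v ve; rewrite (perm_mem pvs) (mem_covered ee).
exists psi; split=> //; apply/setP => e; rewrite EE inE -(perm_mem p_es') es'E.
by apply/mapP/imsetP => -[x]; rewrite ?XE ?inE => hx ->; exists x; rewrite ?XE ?inE.
Qed.

(** [psi] preserves codes, so a stuck arrangement for [X] is one for its image;
    [no_separator_of_stuck] places the remaining vertices. *)
Lemma no_separator_adds_isolated (p m : nat) (X : {set {set 'I_p}}) (xs : seq {set 'I_p})
    (E : {set {set 'I_m}}) (n : nat) :
  X = [set e in xs] -> (forall e, e \in E -> #|e| = 3) -> 1 < size xs ->
  ~~ repeated_column (size xs) (map (code xs) (enum 'I_p)) ->
  reorder_stuck (size xs) n [::] (map (code xs) (enum 'I_p)) -> adds_isolated X E ->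
  exists rho : 'I_m -> nat, [/\ injective rho, forall v, rho v < m &
    forall v, ~ separator E rho v].
Proof.
move=> XE HE xs1 /uniq_of_columns uxs /reorder_stuckP[t pt st] [psi [psi_inj EE]].
have [tau ptau tauE] := perm_map_lift pt.
pose es := [seq psi @: x | x : {set 'I_p} <- xs].
have codeE l : code es (psi l) = code xs l.
  by rewrite /code -map_comp; apply: eq_map => x /=; rewrite mem_imset.
have esE : {subset es <= E}.
  by move=> _ /mapP[x xx ->]; rewrite EE imset_f // XE inE.
apply: (@no_separator_of_stuck _ E es (map psi tau)) => //.
- by rewrite map_inj_uniq //; apply: imset_inj.
- by rewrite size_map.
- by move=> e /esE/HE.
- by rewrite map_inj_uniq // (perm_uniq ptau) enum_uniq.
- move=> _ /mapP[x _ ->] _ /imsetP[l _ ->].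
  by rewrite map_f // (perm_mem ptau) mem_enum.
by rewrite size_map -map_comp (eq_map codeE) tauE.
Qed.

(** * Membership in [calH] and separators *)

Lemma exists_separator (m : nat) (E : {set {set 'I_m}}) :
  (forall e, e \in E -> #|e| = 3) -> calH E -> 0 < m ->
  forall rho : 'I_m -> nat, injective rho -> exists v, separator E rho v.
Proof.
move=> HE [E3 [noTP [noSP noLC]]] m_gt0 rho rho_inj; pose v0 := Ordinal m_gt0.
case: (ltngtP #|E| 3) E3 => // [E2 _|E3 _].
  case: (boolP [exists e1 in E, exists e2 in E, e1 != e2]); last first.
    move=> no; exists v0 => e1 e2 he1 he2 _ _; apply/eqP; move: no.
    apply: contraNT => ne; apply/existsP; exists e1; rewrite he1.
    by apply/existsP; exists e2; rewrite he2.
  case/existsP => e1 /andP[he1 /existsP[e2 /andP[he2 ne]]].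
  (* With two edges, a vertex in only one of them already tells them apart by membership. *)
  have /subsetPn[v v1 v2] : ~~ (e1 \subset e2).
    by apply: contraNN ne => sub; rewrite eqEcard sub !HE.
  have E12 e : e \in E -> (e == e1) || (e == e2).
    move=> he; apply: contraLR E2; rewrite negb_or -leqNgt => /andP[n1 n2].
    have : e |: [set e1; e2] \subset E by rewrite !subUset !sub1set he he1 he2.
    by move/subset_leq_card; rewrite cardsU1 cards2 !inE negb_or n1 n2 ne.
  exists v => f1 f2 /E12/orP[]/eqP-> /E12/orP[]/eqP-> // _; first by rewrite v1 (negbTE v2).
  by rewrite v1 (negbTE v2).
apply: NNPP => /not_ex_all_not nosep; pose es := enum E.
have es3 : size es = 3 by rewrite -cardE.
have EE : E = [set e in es] by apply/setP => e; rewrite inE mem_enum.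
have Ees : {subset E <= es} by move=> e; rewrite mem_enum.
have [s ps st] := stuck_of_no_separator Ees rho_inj nosep.
have := stuck_filter (erefl (degrees (size es) [::])) st.
rewrite filter_map; set s' := filter _ s => st'.
have ps' : perm_eq s' (covered es) by apply: perm_filter.
have pP : perm_eq (map (code es) s') (map (code es) (covered es)) by apply: perm_map.
have card_es e : e \in es -> #|e| = 3 by rewrite mem_enum; exact: HE.
have deg := degrees_covered card_es (covered_uniq es) (@mem_covered _ es).
have nz := @code_covered_nz _ es.
have pR : perm_eq (rev (map (code es) s')) (map (code es) (covered es)) by rewrite perm_rev.
have noR := repeated_columnF (enum_uniq _) (@mem_covered _ es) pR.
rewrite -(degrees_perm _ pP) in deg; rewrite es3 in deg nz noR st'.
have Lnz : {subset map (code es) s' <= nzcodes 3}.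
  by move=> d; rewrite (perm_mem pP); exact: nz.
have := all_stuck3P three_edges_codes Lnz st'; rewrite !cats0 => /(_ deg).
rewrite noR /=.
rewrite -code_TP3 -code_SP3 -code_LC3.
move=> /or3P[] /(adds_isolated_of_codes v0 _ EE _ es3 pR) iso.
- by apply: noTP; apply: iso => //; exact: TP3E.
- by apply: noSP; apply: iso => //; exact: SP3E.
by apply: noLC; apply: iso => //; exact: LC3E.
Qed.

Lemma ordering_without_separator (m : nat) (E : {set {set 'I_m}}) :
  (forall e, e \in E -> #|e| = 3) -> ~ calH E ->
  exists rho : 'I_m -> nat, [/\ injective rho, forall v, rho v < m &
    forall v, ~ separator E rho v].
Proof.
move=> HE nH; have /and4P[/andP[cT sT] /andP[cS sS] /andP[cL sL] _] := isolated_codes_stuck.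
have [E3|E4] := leqP #|E| 3; last first.
  (* Four edges suffice: an ordering with no separator for a subfamily has none for [E]. *)
  pose es := take 4 (enum E).
  have es4 : size es = 4 by rewrite size_takel // -cardE.
  have ues : uniq es by rewrite take_uniq // enum_uniq.
  have esE : {subset es <= E} by move=> e /mem_take; rewrite mem_enum.
  have card_es e : e \in es -> #|e| = 3 by move=> /esE/HE.
  have [s [us cov st]] := four_edges_stuck es4 ues card_es.
  by apply: no_separator_of_stuck us cov st; rewrite ?es4.
apply: NNPP => no; apply: nH; split=> //; split; [|split] => iso; apply: no.
- by apply: no_separator_adds_isolated TP3E HE _ _ _ iso; rewrite ?code_TP3 //; exact: sT.
- by apply: no_separator_adds_isolated SP3E HE _ _ _ iso; rewrite ?code_SP3 //; exact: sS.
by apply: no_separator_adds_isolated LC3E HE _ _ _ iso; rewrite ?code_LC3 //; exact: sL.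
Qed.

(** * The growth rate *)

(** Absorbs the summand 1 of the Erdos-Rado bound, leaving pure powers. *)
Lemma add1_expn_le (q a : nat) : 0 < a -> 1 + q ^ a <= q.+1 ^ a.
Proof.
case: a => // a _; elim: a => [|a IH]; first by rewrite !expn1.
rewrite expnS [_.+1 ^ _]expnS mulSn -add1n leq_add ?expn_gt0 //.
by rewrite leq_mul2l (leq_trans _ IH) ?orbT // leq_addl.
Qed.

(** Each Erdos-Rado step adds one level; the factors 2 and 3 come from squaring and cubing the
    previous bound. *)
Lemma ramsey_bound_tower (q t : nat) : 0 < q -> 0 < t ->
  ramsey_bound 3 q t <= q.+1 ^ (q.+1 ^ (3 * q.+1 ^ (2 * (q.+1 * t)))).
Proof.
move=> q_gt0 t_gt0.
have step r : 0 < ramsey_bound r q t ->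
    ramsey_bound r.+1 q t <= q.+1 ^ (ramsey_bound r q t ^ r.+1).
  move=> M_gt0 /=; rewrite expnSr expnM leq_exp2r //.
  by rewrite add1_expn_le // expn_gt0 M_gt0.
have pos r : 0 < ramsey_bound r q t.
  by case: r => [|r] /=; rewrite ?muln_gt0 ?q_gt0 // expn_gt0.
have b1 : ramsey_bound 1 q t <= q.+1 ^ (q.+1 * t).
  apply: leq_trans (step 0 (pos 0)) _; rewrite leq_exp2l ?ltnS // expn1 /=.
  by rewrite leq_mul2r leqnSn orbT.
have b2 : ramsey_bound 2 q t <= q.+1 ^ (q.+1 ^ (2 * (q.+1 * t))).
  apply: leq_trans (step 1 (pos 1)) _.
  by rewrite leq_exp2l ?ltnS // [2 * _]mulnC expnM leq_exp2r.
apply: leq_trans (step 2 (pos 2)) _.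
by rewrite leq_exp2l ?ltnS // [3 * _]mulnC expnM leq_exp2r.
Qed.

(** * Iterated logarithms *)

Local Open Scope R_scope.

Lemma INR_expn (a b : nat) : INR (expn a b) = INR a ^ b.
Proof. by elim: b => [|b IH] //=; rewrite expnS -multE mult_INR IH. Qed.

Lemma le_INR_leq (a b : nat) : (a <= b)%N -> INR a <= INR b.
Proof. by move=> /leP; apply: le_INR. Qed.

Lemma ln_le (x y : R) : 0 < x -> x <= y -> ln x <= ln y.
Proof. by move=> x0 [lt|->]; [left; apply: ln_increasing | right]. Qed.

Lemma ln_le_pow (x y : R) (K : nat) : 0 < y -> 0 < x -> y <= x ^ K ->
  ln y <= INR K * ln x.
Proof. by move=> y0 x0 le; rewrite -ln_pow //; apply: ln_le. Qed.

Lemma ln_le_self (x : R) : 0 < x -> ln x <= x.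
Proof.
move=> x0; rewrite -[X in _ <= X]ln_exp; apply: ln_le => //.
by have := exp_ineq1_le x; lra.
Qed.

Lemma exp_le_ln (a x : R) : exp a <= x -> a <= ln x.
Proof. by move=> le; rewrite -[a]ln_exp; apply: ln_le => //; apply: exp_pos. Qed.

(** A logarithm strips one level and leaves a factor [ln Q], bounded by [Q], which costs one more in
    the exponent. *)
Lemma ln_le_tower (y : R) (Q K L : nat) : (0 < Q)%N -> (K.+1 <= L)%N ->
  0 < y -> y <= INR Q ^ (expn Q K) -> ln y <= INR Q ^ L.
Proof.
move=> Q0 KL y0 le; have x1 : 1 <= INR Q by apply: (le_INR_leq Q0).
apply: (Rle_trans _ (INR Q ^ K.+1)); last by apply: Rle_pow => //; apply/leP.
have x0 : 0 < INR Q by lra.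
apply: Rle_trans (ln_le_pow y0 x0 le) _.
rewrite INR_expn [INR Q ^ K.+1]/= Rmult_comm; apply: Rmult_le_compat_r; last exact: ln_le_self.
by apply: pow_le; lra.
Qed.

(** The first two logarithms give [ln Q] away; the third keeps it, and it becomes the fourth
    iterated logarithm of the rate. *)
Lemma iterlog3_le (n Q t : nat) : (1 < Q)%N -> (0 < t)%N ->
  0 < ln (INR n) -> 0 < ln (ln (INR n)) -> 0 < INR n ->
  (n <= Q ^ (Q ^ (3 * Q ^ (2 * (Q * t)))))%N ->
  ln (ln (ln (INR n))) <= 5 * INR t * INR Q * ln (INR Q).
Proof.
move=> Q1 t0 l1 l2 n0 /le_INR_leq; rewrite INR_expn => le.
have Q0 : (0 < Q)%N by apply: ltnW.
have le1 : ln (INR n) <= INR Q ^ (expn Q (2 * (Q * t) + 2)).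
  apply: (ln_le_tower Q0 _ n0 le).
  rewrite expnD; have : (0 < Q ^ (2 * (Q * t)))%N by rewrite expn_gt0 Q0.
  have : (4 <= Q ^ 2)%N by rewrite (@leq_exp2r 2 Q 2).
  by set a := (Q ^ (2 * _))%N; set b := (Q ^ 2)%N; nia.
have le2 : ln (ln (INR n)) <= INR Q ^ (2 * (Q * t) + 3).
  by apply: (ln_le_tower Q0 _ l1 le1); rewrite -addnS.
have x0 : 0 < INR Q by apply: (lt_INR 0); apply/leP.
apply: Rle_trans (ln_le_pow l2 x0 le2) _.
apply: Rmult_le_compat_r.
  rewrite -ln_1; apply: ln_le; first lra.
  by apply: (le_INR_leq Q0).
have -> : 5 * INR t * INR Q = INR (5 * (Q * t)).
  by rewrite -!multE !mult_INR /=; lra.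
by apply: le_INR_leq; nia.
Qed.

Lemma rate_le (L x t k : R) : exp 1 <= L -> 1 <= t -> 1 <= x -> 1 <= k ->
  L <= 5 * t * x * ln x -> x <= 2 * k ^ 16 ->
  / Rpower (10 * t) (1 / 16) * Rpower (L / ln L) (1 / 16) <= k.
Proof.
move=> Le t1 x1 k1 Lx xk.
have L0 : 0 < L by have := exp_pos 1; lra.
have lnL : 1 <= ln L by apply: exp_le_ln.
have Lpos : 0 < L / ln L by apply: Rdiv_lt_0_compat; lra.
have le : L / ln L <= 5 * t * x.
  apply: (Rmult_le_reg_r (ln L)); first lra.
  have -> : L / ln L * ln L = L by field; lra.
  (* If [L <= x], then [t * ln L >= 1] is enough; otherwise [ln x <= ln L] cancels the
     denominator. *)
  case: (Rle_lt_dec L x) => Lx'.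
    have : 1 <= t * ln L by nra.
    by nra.
  have : ln x <= ln L by apply: ln_le; lra.
  move=> lnle; apply: Rle_trans Lx _; apply: Rmult_le_compat_l => //; nra.
have k0 : 0 < k ^ 16 by apply: pow_lt; lra.
have le2 : L / ln L <= 10 * t * k ^ 16 by nra.
have P0 : 0 < Rpower (10 * t) (1 / 16) by apply: exp_pos.
apply: (Rmult_le_reg_l (Rpower (10 * t) (1 / 16))) => //.
rewrite -Rmult_assoc Rinv_r ?Rmult_1_l; last lra.
apply: Rle_trans (_ : Rpower (10 * t * k ^ 16) (1 / 16) <= _).
  by apply: Rle_Rpower_l; lra.
rewrite -Rpower_mult_distr //; last lra.
rewrite -Rpower_pow; last lra.
rewrite Rpower_mult (_ : INR 16 * (1 / 16) = 1) ?Rpower_1; try lra.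
by rewrite /=; field.
Qed.

(** * Bounds on [C3] *)

Lemma C3_le_7 (m n : nat) (E : {set {set 'I_m}}) :
  (forall e, e \in E -> #|e| = 3%N) -> calH E -> (C3 n E <= 7)%N.
Proof.
case: m E => [|m] E HE cE.
  (* The empty injection leaves no vertex to choose, so no colouring exists and [C3] is 0 by
     convention. *)
  rewrite /C3; case: excluded_middle_informative => // h.
  have [k /has_lcbP[f fE]] := h.
  have inj0 : injective (fun i : 'I_0 => widen_ord (leq0n n) i) by case.
  by have [[]] := fE _ inj0.
have col : has_local_coloring n 7 E.
  by apply: has_local_coloring_7 => //; apply: exists_separator.
by have [] := C3_spec col.
Qed.

Lemma C3_lower_bound (m : nat) (E : {set {set 'I_m}}) :
  (forall e, e \in E -> #|e| = 3%N) -> ~ calH E ->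
  exists c : R, 0 < c /\ exists N : nat, forall n : nat, (N <= n)%N ->
    c * Rpower (iterlog 3 (INR n) / iterlog 4 (INR n)) (1 / 16) <= INR (C3 n E).
Proof.
move=> HE ncE.
have [rho [rho_inj rho_lt nosep]] := ordering_without_separator HE ncE.
(* A 3-graph without vertices has no edges, so it lies in [calH]. *)
have m_gt0 : (0 < m)%N.
  case: m E HE ncE {rho rho_inj rho_lt nosep} => // E HE []; split.
    rewrite (_ : E = set0) ?cards0 //; apply/setP => e; rewrite inE; apply/negP => /HE e3.
    by have := max_card (mem e); rewrite e3 card_ord.
  by split; [|split] => -[psi _]; case: (psi ord0).
exists (/ Rpower (10 * INR m.+1) (1 / 16)); split.
  by apply: Rinv_0_lt_compat; apply: exp_pos.
(* Four exponentials make the third iterated logarithm at least [exp 1], hence the fourth at least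
   1. *)
have [N hN] := INR_unbounded (exp (exp (exp (exp 1)))).
exists N => n /le_INR_leq hn.
have n4 : exp (exp (exp (exp 1))) <= INR n by lra.
have n3 := exp_le_ln n4; have n2 := exp_le_ln n3; have n1 := exp_le_ln n2.
have n0 : 0 < INR n by apply: Rlt_le_trans n4; apply: exp_pos.
have l1 : 0 < ln (INR n) by apply: Rlt_le_trans n3; apply: exp_pos.
have l2 : 0 < ln (ln (INR n)) by apply: Rlt_le_trans n2; apply: exp_pos.
have n_gt0 : (0 < n)%N by case: n n0 {hn n4 n3 n2 n1 l1 l2} => //= /Rlt_irrefl.
have [col _] := C3_spec (has_local_coloring_rainbow n E m_gt0).
set k := C3 n E in col *.
have k_gt0 : (0 < k)%N.
  by have [f _] := col; have := f (Ordinal n_gt0) set0; case: k {f col} => // -[].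
(* Otherwise a homogeneous set would give [rho] a separator. *)
have small : (n < ramsey_bound 3 (k ^ 16) m.+1)%N.
  rewrite ltnNge; apply/negP => /(separator_of_local_coloring HE n_gt0 col).
  by move=> /(_ _ rho_inj rho_lt)[v /nosep].
have q_gt0 : (0 < k ^ 16)%N by rewrite expn_gt0 k_gt0.
have k1 : 1 <= INR k by apply: (le_INR_leq k_gt0).
apply: (@rate_le _ (INR (k ^ 16).+1)) => //.
- exact: (@le_INR_leq 1).
- exact: (@le_INR_leq 1).
- apply: iterlog3_le => //.
  by apply: ltnW; apply: leq_trans small _; apply: ramsey_bound_tower.
(* Since [k >= 1], the base [k ^ 16 + 1] is at most [2 * k ^ 16]. *)
rewrite S_INR INR_expn.
by have := pow_R1_Rle _ 16 k1; lra.
Qed.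

Local Close Scope R_scope.

Theorem theorem1 (m : nat) (E : {set {set 'I_m}})
  (HE : forall e, e \in E -> #|e| = 3) :
  (calH E -> forall n : nat, (C3 n E <= 7)%N) /\
  (~ calH E ->
     exists c : R, Rlt 0 c /\
     exists N : nat, forall n : nat, (N <= n)%N ->
       Rle (Rmult c (Rpower (Rdiv (iterlog 3 (INR n)) (iterlog 4 (INR n)))
                            (Rdiv 1 16)))
           (INR (C3 n E))).
Proof.
by split=> [cE n|]; [apply: C3_le_7 | apply: C3_lower_bound].
Qed.
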